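(* Let $\mathcal{A}$ be a unital $C^*$-algebra, $\mathcal{H}$ a Hilbert $\mathcal{A}$-module, and $\mathbb{J}\subseteq\mathbb{N}$ a finite or countable index set. For $n=1,2,\dots,k$, let $\{T_{n,i}\}_{i\in\mathbb{J}}\subset End_{\mathcal{A}}^{*}(\mathcal{H})$ be an operator frame for $End_{\mathcal{A}}^{*}(\mathcal{H})$ with bounds $A_n$ and $B_n$, and let $\{R_{n,i}\}_{i\in\mathbb{J}}\subset End_{\mathcal{A}}^{*}(\mathcal{H})$ be any sequence. Let $L:\ell^2(\mathcal{H})\to\ell^2(\mathcal{H})$ be a bounded linear operator such that, for some $p\in\{1,2,\dots,k\}$, $$L\Big(\Big\{\sum_{n=1}^{k}R_{n,i}(x)\Big\}_{i}\Big)=\{T_{p,i}(x)\}_{i}\qquad\text{for all }x\in\mathcal{H}.$$ If there exists a constant $\lambda>0$ such that $$\Big\|\sum_{i}\langle(T_{n,i}-R_{n,i})x,(T_{n,i}-R_{n,i})x\rangle\Big\|\le\lambda\Big\|\sum_{i}\langle T_{n,i}x,T_{n,i}x\rangle\Big\|\qquad\text{for all }x\in\mathcal{H},\ n=1,2,\dots,k,$$ then $\big\{\sum_{n=1}^{k}R_{n,i}\big\}_{i\in\mathbb{J}}$ is an operator frame for $End_{\mathcal{A}}^{*}(\mathcal{H})$.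
   Context: Hilbert $\mathcal{A}$-modules are left modules with $\mathcal{A}$-valued inner product $\langle\cdot,\cdot\rangle$, $\mathcal{A}$-linear in the first variable, with $\langle x,y\rangle=\langle y,x\rangle^*$, complete for $\|x\|=\|\langle x,x\rangle\|^{1/2}$. $End_{\mathcal{A}}^{*}(\mathcal{H})$ is the set of adjointable operators on $\mathcal{H}$. Inequalities between elements of $\mathcal{A}$ refer to the usual order given by the positive cone of $\mathcal{A}$. A family $\{T_i\}_{i\in\mathbb{J}}\subset End_{\mathcal{A}}^{*}(\mathcal{H})$ is an operator frame for $End_{\mathcal{A}}^{*}(\mathcal{H})$ with (lower and upper) bounds $A,B>0$ if $A\langle x,x\rangle\le\sum_{i\in\mathbb{J}}\langle T_ix,T_ix\rangle\le B\langle x,x\rangle$ for all $x\in\mathcal{H}$; it is an operator frame if such constants exist. $\ell^2(\mathcal{H})$ is the Hilbert $\mathcal{A}$-module of sequences $\{x_i\}_{i\in\mathbb{J}}$ in $\mathcal{H}$ with $\sum_i\langle x_i,x_i\rangle$ norm convergent, and $\|\{x_i\}_i\|=\|\sum_{i}\langle x_i,x_i\rangle\|^{1/2}$. Convention: all series of the form $\sum_{i\in\mathbb{J}}\langle T_ix,T_ix\rangle$ are taken to converge in norm in $\mathcal{A}$ (i.e. $\{T_ix\}_i\in\ell^2(\mathcal{H})$); this convergence is part of the notion of operator frame, and an inequality involving such series includes the assertion that the series appearing in it converge in norm. *)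

(* Defs.v *)
From HB Require Import structures.
From mathcomp Require Import all_boot all_order all_algebra.
From mathcomp Require Import complex.
From mathcomp Require Import all_classical all_reals.
From mathcomp Require Import topology normedtype sequences.

Set Implicit Arguments.
Unset Strict Implicit.
Unset Printing Implicit Defensive.

Import Order.TTheory GRing.Theory Num.Theory.
Import numFieldNormedType.Exports.

Local Open Scope classical_set_scope.
Local Open Scope ring_scope.
Local Open Scope complex_scope.

(* Norms of normed modules over R[i] take values in R[i]; there [x <= y] means
   that [y - x] is a nonnegative real, so norm inequalities read as usual. *)

(* The multiplication is a field of the mixin because Hierarchy Builder rejects
   a new structure joining semi-normed zmodules and semirings (numDomainType
   already does). The instance below gives every C*-algebra its ring structure,
   with [a * b] and [1] standing for [cmul a b] and [cone]. The zero algebra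
   (1 = 0) is allowed, hence a pzRingType. *)
HB.mixin Record isCStarAlgebra (R : realType) A
    of CompleteNormedModule R[i] A := {
  cmul : A -> A -> A ;
  cone : A ;
  cmulA : associative cmul ;
  cmul1l : left_id cone cmul ;
  cmul1r : right_id cone cmul ;
  cmulDl : left_distributive cmul +%R ;
  cmulDr : right_distributive cmul +%R ;
  cmulZl : forall (z : R[i]) (a b : A), z *: cmul a b = cmul (z *: a) b ;
  cmulZr : forall (z : R[i]) (a b : A), z *: cmul a b = cmul a (z *: b) ;
  star : A -> A ;
  starK : involutive star ;
  starD : {morph star : a b / a + b} ;
  starZ : forall (z : R[i]) (a : A), star (z *: a) = Num.conj z *: star a ;
  cstarM : forall a b : A, star (cmul a b) = cmul (star b) (star a) ;
  cnormM_le : forall a b : A, `|cmul a b| <= `|a| * `|b| ;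
  cnorm_star : forall a : A, `|cmul (star a) a| = `|a| ^+ 2
}.

#[short(type="cstarAlgType")]
HB.structure Definition CStarAlgebra (R : realType) :=
  {A of CompleteNormedModule R[i] A & isCStarAlgebra R A}.

HB.instance Definition _ (R : realType) (A : cstarAlgType R) :=
  GRing.Zmodule_isPzRing.Build A
    cmulA cmul1l cmul1r cmulDl cmulDr.

Section Positivity.
Variables (R : realType) (A : cstarAlgType R).

Definition invertible (a : A) : Prop := exists b : A, a * b = 1 /\ b * a = 1.

Definition spectrum (a : A) : set R[i] :=
  [set z | ~ invertible (a - z *: (1 : A))].

(* In R[i], [0 <= z] says that z is real and nonnegative. *)
Definition cstar_pos (a : A) : Prop :=
  star a = a /\ forall z, spectrum a z -> 0 <= z.

Definition cstar_le (a b : A) : Prop := cstar_pos (b - a).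

End Positivity.

(* The action of A is a separate operation [act] because [*:] denotes the
   scaling by R[i]; [act_scale] says that the latter is induced by A, and
   [norm_inner] that the (complete) norm is the one given by the inner product. *)
HB.mixin Record isHilbertModule (R : realType) (A : cstarAlgType R) H
    of CompleteNormedModule R[i] H := {
  act : A -> H -> H ;
  actDl : forall (a b : A) (x : H), act (a + b) x = act a x + act b x ;
  actDr : forall (a : A) (x y : H), act a (x + y) = act a x + act a y ;
  actM : forall (a b : A) (x : H), act (a * b) x = act a (act b x) ;
  act_scale : forall (z : R[i]) (x : H), act (z *: (1 : A)) x = z *: x ;
  inner : H -> H -> A ;
  innerDl : forall x y z : H, inner (x + y) z = inner x z + inner y z ;
  inner_act : forall (a : A) (x y : H), inner (act a x) y = a * inner x y ;
  inner_star : forall x y : H, inner x y = star (inner y x) ;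
  inner_pos : forall x : H, cstar_pos (inner x x) ;
  inner_eq0 : forall x : H, inner x x = 0 -> x = 0 ;
  norm_inner : forall x : H, `|x| = sqrtC `|inner x x|
}.

#[short(type="hilbertModType")]
HB.structure Definition HilbertModule (R : realType) (A : cstarAlgType R) :=
  {H of CompleteNormedModule R[i] H & isHilbertModule R A H}.

Section OperatorFrames.
Variables (R : realType) (A : cstarAlgType R) (H : hilbertModType A).

(* A map with an adjoint is automatically A-linear and bounded. *)
Definition adjointable (T : H -> H) : Prop :=
  exists T' : H -> H, forall x y : H,
    inner (T x) y = inner x (T' y) :> A.

Variable J : set nat.

(* Families indexed by J are functions on the subtype of nat given by J; a
   series over J is summed in the increasing order of the indices, the order
   being immaterial for the norm convergence of series of positive elements. *)
Definition partial_sum (f : J -> A) : A^nat :=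
  fun n => \sum_(i < n) oapp f 0 (insub (i : nat)).

Definition summable (f : J -> A) : Prop := cvgn (partial_sum f).

Definition series_sum (f : J -> A) : A := limn (partial_sum f).

Definition sqnorm (x : J -> H) : J -> A := fun i => inner (x i) (x i).

Definition ell2 : set (J -> H) := [set x | summable (sqnorm x)].

Definition ell2_norm (x : J -> H) : R[i] := sqrtC `|series_sum (sqnorm x)|.

(* Only the restriction of L to ell2 matters. *)
Definition ell2_bounded_linear (L : (J -> H) -> (J -> H)) : Prop :=
  [/\ forall x, ell2 x -> ell2 (L x),
      forall (a : R[i]) x y, ell2 x -> ell2 y ->
        L (fun i => a *: x i + y i) = (fun i => a *: L x i + L y i)
    & exists M : R, forall x, ell2 x -> ell2_norm (L x) <= M%:C * ell2_norm x].

Definition operator_frame_bounds (T : J -> H -> H) (a b : R) : Prop :=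
  [/\ forall i, adjointable (T i), 0 < a, 0 < b
    & forall x : H,
      [/\ ell2 (T^~ x),
          cstar_le (a%:C *: (inner x x : A)) (series_sum (sqnorm (T^~ x)))
        & cstar_le (series_sum (sqnorm (T^~ x))) (b%:C *: (inner x x : A))]].

Definition operator_frame (T : J -> H -> H) : Prop :=
  exists a b : R, operator_frame_bounds T a b.

End OperatorFrames.

(* Main.v *)
Require Import Defs.
From mathcomp Require Import all_boot all_order all_algebra.
From mathcomp Require Import complex.
From mathcomp Require Import all_classical all_reals.
From mathcomp Require Import topology normedtype sequences.
From mathcomp Require Import lra.
Import Order.TTheory GRing.Theory Num.Theory.
Import numFieldNormedType.Exports.
Local Open Scope ring_scope.
Local Open Scope complex_scope.

Set Implicit Arguments.
Unset Strict Implicit.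

(* Write [V] for the family of the sums [\sum_n U n i]. The triangle inequality
   in l^2(H) and the boundedness of [L] give, for norms only,
     c ||<x,x>|| <= ||\sum_i <V i x, V i x>|| <= C ||<x,x>||.
   Both bounds become inequalities in the algebra [A]: replacing [x] by
   [(q x + e)^(-1/2) x], where [q x] is the form on the larger side, normalizes
   that side to norm at most 1, so the other one is at most a constant times 1,
   and one conjugates back by [(q x + e)^(1/2)] and lets [e] tend to 0. The only
   C*-theory needed is that the norm of a self-adjoint element is attained on its
   spectrum; this is proved without complex analysis, by Rickart's argument
   comparing the resolvents at radius 1 and [r < 1] under repeated squaring. *)

(** * The norm of the algebra as a real number *)

Section Norm.
Variables (R : realType) (A : cstarAlgType R).
Implicit Types a b c x y : A.
Implicit Types z w : R[i].

(** Norms are nonnegative reals inside [R[i]]; the real part moves all estimates to [R], where [lra]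
    and [nra] apply. *)
Definition rnorm a : R := complex.Re `|a|.

Lemma rnormE a : `|a| = (rnorm a)%:C.
Proof. by rewrite /rnorm RRe_real// ger0_real. Qed.

Lemma rnorm_ge0 a : 0 <= rnorm a.
Proof. by rewrite -ler0c -rnormE. Qed.

Lemma rnorm0 : rnorm 0 = 0.
Proof. by apply/eqP; rewrite -(inj_eq (@complexI R)) -rnormE normr0. Qed.

Lemma rnorm_eq0 a : rnorm a = 0 -> a = 0.
Proof. by move=> a0; apply: (@normr0_eq0 _ A); rewrite rnormE a0. Qed.

Lemma rnormN a : rnorm (- a) = rnorm a.
Proof. by rewrite /rnorm normrN. Qed.

Lemma rnormD a b : rnorm (a + b) <= rnorm a + rnorm b.
Proof. by rewrite -lecR rmorphD /= -!rnormE ler_normD. Qed.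

Lemma rdistC a b : rnorm (a - b) = rnorm (b - a).
Proof. by rewrite -rnormN opprB. Qed.

Lemma rnormB a b : rnorm (a - b) <= rnorm a + rnorm b.
Proof. by rewrite -(rnormN b) rnormD. Qed.

Lemma rdistD c a b : rnorm (a - b) <= rnorm (a - c) + rnorm (c - b).
Proof. by have := rnormD (a - c) (c - b); rewrite addrA subrK. Qed.

Lemma rnormM a b : rnorm (a * b) <= rnorm a * rnorm b.
Proof. by rewrite -lecR rmorphM /= -!rnormE; exact: cnormM_le. Qed.

Lemma rnormZ z a : rnorm (z *: a) = complex.Re `|z| * rnorm a.
Proof.
have zE : `|z| = (complex.Re `|z|)%:C by rewrite RRe_real// ger0_real.
by apply: (@complexI R); rewrite rmorphM /= -zE -!rnormE normrZ.
Qed.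

Lemma rnormZr (t : R) a : rnorm (t%:C *: a) = `|t| * rnorm a.
Proof. by rewrite rnormZ normc_def /= expr0n /= addr0 sqrtr_sqr. Qed.

Lemma starM a b : star (a * b) = star b * star a.
Proof. exact: cstarM. Qed.

Lemma mulZl z a b : (z *: a) * b = z *: (a * b).
Proof. by symmetry; exact: cmulZl. Qed.

Lemma mulZr z a b : a * (z *: b) = z *: (a * b).
Proof. by symmetry; exact: cmulZr. Qed.

Lemma star1 : star (1 : A) = 1.
Proof. by rewrite -[LHS]mulr1 -[X in _ * X]starK -starM mulr1 starK. Qed.

Lemma star0 : star (0 : A) = 0.
Proof. by apply: (addrI (star (0 : A))); rewrite -starD !addr0. Qed.

Lemma starN a : star (- a) = - star a.
Proof. by apply: (addrI (star a)); rewrite -starD !subrr star0. Qed.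

Lemma starB a b : star (a - b) = star a - star b.
Proof. by rewrite starD starN. Qed.

Lemma starZr (t : R) a : star (t%:C *: a) = t%:C *: star a.
Proof. by rewrite starZ conj_Creal//; apply/complex_realP; exists t. Qed.

Lemma rnorm_starM a : rnorm (star a * a) = rnorm a ^+ 2.
Proof.
by apply: (@complexI R); rewrite rmorphXn /= -!rnormE; exact: cnorm_star.
Qed.

Lemma rnorm_star a : rnorm (star a) = rnorm a.
Proof.
have le b : rnorm b <= rnorm (star b).
  have := rnormM (star b) b; rewrite rnorm_starM expr2.
  have [b0 _|b0] := leP (rnorm b) 0; first exact: le_trans (rnorm_ge0 _).
  by rewrite ler_pM2r.
by apply/eqP; rewrite eq_le le andbT -[X in _ <= rnorm X]starK le.
Qed.

(** The C*-identity at [1] gives [|1| = |1|^2]. Equality fails in the zero algebra, hence the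
    inequality. *)
Lemma rnorm1_le1 : rnorm (1 : A) <= 1.
Proof.
have := rnorm_starM 1; rewrite star1 mulr1 => h.
have := rnorm_ge0 1; nra.
Qed.

Lemma rnorm_cvgP (u : nat -> A) a :
  (u @ \oo --> a)%classic <->
  forall e : R, 0 < e -> exists N, forall n, (N <= n)%N -> rnorm (a - u n) < e.
Proof.
split=> [/cvgrPdist_lt h e e0|h].
  have [|N _ hN] := h e%:C; first by rewrite -[0]/(0%:C) ltcR.
  by exists N => n /hN; rewrite /= rnormE ltcR.
apply/cvgrPdist_lt => z z0.
have zE : z = (complex.Re z)%:C by rewrite RRe_real// gtr0_real.
have [|N hN] := h (complex.Re z); first by rewrite -ltcR -zE.
by exists N => // n /hN; rewrite /= zE rnormE ltcR.
Qed.

Lemma rnorm_cauchy (u : nat -> A) :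
  (forall e : R, 0 < e -> exists N, forall m n, (N <= m)%N -> (m <= n)%N ->
    rnorm (u n - u m) < e) -> cvgn u.
Proof.
move=> h; apply: cauchy_cvg; apply: cauchy_exP => z z0.
have zE : z = (complex.Re z)%:C by rewrite RRe_real// gtr0_real.
have [|N hN] := h (complex.Re z); first by rewrite -ltcR -zE.
exists (u N); exists N => // n /= Nn.
by rewrite -ball_normE /= zE rnormE ltcR rdistC hN.
Qed.

End Norm.

(** * Inverses with norm bounds, and square roots, by contraction *)

Section Inverse.
Variables (R : realType) (A : cstarAlgType R).
Implicit Types a b c x y : A.
Implicit Types z w : R[i].
Implicit Types t : R.

Lemma expr_lt_eps (q r e : R) : 0 <= q < 1 -> 0 < e ->
  exists N, forall n, (N <= n)%N -> q ^+ n * r < e.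
Proof.
move=> /andP[q0 q1] e0.
have /cvgrPdist_lt/(_ e e0)[N _ hN] : (geometric r q @ \oo --> (0 : R))%classic.
  by apply: cvg_geometric; rewrite ger0_norm.
exists N => n /hN /=; rewrite sub0r normrN mulrC; exact/le_lt_trans/ler_norm.
Qed.

(** Banach's fixed point theorem on a closed ball. The iterates start at the centre [0], so
    [u m - u 0] has norm at most [r], and [n] applications of [F] shrink this to [q ^+ n * r]. *)
Lemma contraction_fixpoint (F : A -> A) (q r : R) :
  0 <= q < 1 -> 0 <= r ->
  (forall x, rnorm x <= r -> rnorm (F x) <= r) ->
  (forall x y, rnorm x <= r -> rnorm y <= r ->
    rnorm (F x - F y) <= q * rnorm (x - y)) ->
  exists2 x, rnorm x <= r & F x = x.
Proof.
move=> q01 r0 Fr Fq; have /andP[q0 q1] := q01.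
pose u n := iter n F 0.
have ur n : rnorm (u n) <= r by elim: n => [|n /Fr //]; rewrite rnorm0.
have ud m n : rnorm (u (n + m)%N - u n) <= q ^+ n * r.
  elim: n => [|n ih]; first by rewrite /= subr0 expr0 mul1r.
  by rewrite exprS -mulrA; apply: le_trans (Fq _ _ (ur _) (ur _)) (ler_wpM2l q0 ih).
have /cvg_ex[l /rnorm_cvgP ul] : cvgn u.
  apply: rnorm_cauchy => e e0; have [N hN] := expr_lt_eps r q01 e0.
  exists N => m n Nm mn; rewrite -(subnKC mn).
  exact: le_lt_trans (ud _ _) (hN _ Nm).
have lr : rnorm l <= r.
  apply/ler_addgt0Pl => e /ul[N /(_ N (leqnn _)) lN].
  have := rnormD (l - u N) (u N); rewrite subrK => h.
  by apply: le_trans h _; apply: lerD (ltW lN) (ur N).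
exists l => //; apply/eqP; rewrite -subr_eq0; apply/eqP/rnorm_eq0/eqP.
rewrite eq_le rnorm_ge0 andbT; apply/ler_addgt0Pr => e e0; rewrite add0r.
(* Both [F l] and [l] are within [e / 2] of [u N.+1]. *)
have [N lN] := ul (e / 2) ltac:(by lra).
have l0 := lN N (leqnn _); have l1 := lN N.+1 (leqnSn _).
have := Fq l (u N) lr (ur N); have := rdistD (F (u N)) (F l) l.
have -> : F (u N) = u N.+1 by [].
have := rnorm_ge0 (l - u N); rewrite (rdistC (u N.+1) l); nra.
Qed.

(** The bound on the inverse controls how far [a] may be perturbed, see [inv_boundD]. *)
Definition inv_bound a (K : R) :=
  exists b, [/\ a * b = 1, b * a = 1 & rnorm b <= K].

Lemma inv_bound_invertible a K : inv_bound a K -> invertible a.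
Proof. by case=> b [ab ba _]; exists b. Qed.

Lemma invertible_inv_bound a : invertible a -> exists2 K, 0 < K & inv_bound a K.
Proof.
case=> b [ab ba]; exists (rnorm b + 1); first by have := rnorm_ge0 b; lra.
by exists b; split=> //; lra.
Qed.

Lemma inv_bound_le a K K' : K <= K' -> inv_bound a K -> inv_bound a K'.
Proof. by move=> KK [b [ab ba bK]]; exists b; split=> //; lra. Qed.

Lemma mulr_inv_eq a b c : b * a = 1 -> a * c = 1 -> b = c.
Proof. by move=> ba ac; rewrite -[b]mulr1 -ac mulrA ba mul1r. Qed.

(** The sum of the Neumann series is the fixed point of [b -> 1 + x * b] (right inverse) and of
    [b -> 1 + b * x] (left inverse). The radius [r] solves [1 + q * r = r], so the ball is
    preserved. *)
Lemma inv_bound_1B x : rnorm x < 1 -> inv_bound (1 - x) (1 - rnorm x)^-1.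
Proof.
move=> x1; set q := rnorm x; have q0 : 0 <= q := rnorm_ge0 x.
have q1 : 0 < 1 - q by rewrite subr_gt0.
set r := (1 - q)^-1; have r0 : 0 < r by rewrite invr_gt0.
have rE : r * (1 - q) = 1 by rewrite mulVf// gt_eqF.
have N1 := rnorm1_le1 A.
have [||||b br bE] := @contraction_fixpoint (fun b => 1 + x * b) q r.
- by rewrite q0.
- exact: ltW.
- move=> b br; have := rnormD 1 (x * b); have := rnormM x b; rewrite -/q; nra.
- by move=> b c _ _; rewrite /= opprD addrACA subrr add0r -mulrBr; exact: rnormM.
have [||||c cr cE] := @contraction_fixpoint (fun b => 1 + b * x) q r.
- by rewrite q0.
- exact: ltW.
- move=> c cr; have := rnormD 1 (c * x); have := rnormM c x; rewrite -/q; nra.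
- by move=> c d _ _; rewrite /= opprD addrACA subrr add0r -mulrBl mulrC; exact: rnormM.
have xb : (1 - x) * b = 1 by rewrite mulrBl mul1r -{1}bE addrK.
have cx : c * (1 - x) = 1 by rewrite mulrBr mulr1 -{1}cE addrK.
by exists b; split=> //; rewrite -(mulr_inv_eq cx xb).
Qed.

Lemma inv_boundM a b K L : inv_bound a K -> inv_bound b L ->
  inv_bound (a * b) (L * K).
Proof.
move=> [c [ac ca cK]] [d [bd db dL]]; exists (d * c); split.
- by rewrite mulrA -(mulrA a) bd mulr1.
- by rewrite mulrA -(mulrA d) ca mulr1.
- apply: le_trans (rnormM d c) _.
  have := rnorm_ge0 c; have := rnorm_ge0 d; nra.
Qed.

Lemma invertibleM a b : invertible a -> invertible b -> invertible (a * b).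
Proof.
move=> /invertible_inv_bound[K _ aK] /invertible_inv_bound[L _ bL].
exact: inv_bound_invertible (inv_boundM aK bL).
Qed.

Lemma inv_boundZ a K z : z != 0 -> inv_bound a K ->
  inv_bound (z *: a) (complex.Re `|z^-1| * K).
Proof.
move=> z0 [b [ab ba bK]]; exists (z^-1 *: b); split.
- by rewrite mulZl mulZr ab scalerA divff ?scale1r.
- by rewrite mulZl mulZr ba scalerA mulVf ?scale1r.
- rewrite rnormZ ler_wpM2l//.
  by have := normr_ge0 z^-1; rewrite lecE => /andP[].
Qed.

Lemma invertibleZ a z : z != 0 -> invertible a -> invertible (z *: a).
Proof.
move=> z0 /invertible_inv_bound[K _ aK].
exact: inv_bound_invertible (inv_boundZ z0 aK).
Qed.

Lemma invertibleN a : invertible a -> invertible (- a).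
Proof. by rewrite -scaleN1r; apply: invertibleZ; rewrite oppr_eq0 oner_eq0. Qed.

(** With [b] the inverse of [a], [a + d = a * (1 + b * d)] and [b * d] has norm at most [1 / 2], so
    the second factor has an inverse of norm at most 2. *)
Lemma inv_boundD a d K : inv_bound a K -> rnorm d * K <= 1 / 2 ->
  inv_bound (a + d) (2 * K).
Proof.
move=> aK dK; have [b [ab ba bK]] := aK.
have bd : rnorm (- (b * d)) <= 1 / 2.
  rewrite rnormN; apply: le_trans (rnormM b d) _.
  have := rnorm_ge0 d; nra.
have -> : a + d = a * (1 - - (b * d)).
  by rewrite opprK mulrDr mulr1 mulrA ab mul1r.
apply: inv_boundM => //; apply: inv_bound_le (inv_bound_1B _); last lra.
by rewrite invf_ple ?posrE; lra.
Qed.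

Lemma invertible_scalarB a t : rnorm a < t -> invertible (t%:C *: (1 : A) - a).
Proof.
move=> at_; have t0 : 0 < t := le_lt_trans (rnorm_ge0 a) at_.
have tn : t%:C != 0 by rewrite -[0]/(0%:C) (inj_eq (@complexI R)) gt_eqF.
have -> : t%:C *: (1 : A) - a = t%:C *: (1 - t^-1%:C *: a).
  by rewrite scalerBr scalerA fmorphV /= divff // scale1r.
apply: invertibleZ => //; apply/inv_bound_invertible/inv_bound_1B.
by rewrite rnormZr gtr0_norm ?invr_gt0// mulrC ltr_pdivrMr// mul1r.
Qed.

Lemma star_invertible_inv a b : star a = a -> a * b = 1 -> b * a = 1 ->
  star b = b.
Proof.
by move=> sa ab ba; apply: (@mulr_inv_eq a) => //; rewrite -{1}sa -starM ab star1.
Qed.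

(* Writing [s = 1 - y], the equation [s * s = 1 - x] is the fixed point equation
   [y = (x + y * y) / 2], a contraction of the ball of radius [|x| < 1]. *)
Lemma sqrt_1B x : star x = x -> rnorm x < 1 ->
  exists s, [/\ star s = s, s * s = 1 - x & invertible s].
Proof.
move=> sx x1; set q := rnorm x; have q0 : 0 <= q := rnorm_ge0 x.
pose F y := (2^-1 : R)%:C *: (x + y * y).
have q01 : 0 <= q < 1 by rewrite q0.
have Fq y y' : rnorm y <= q -> rnorm y' <= q ->
    rnorm (F y - F y') <= q * rnorm (y - y').
  move=> yq yq'; rewrite -scalerBr opprD addrACA subrr add0r.
  rewrite rnormZr gtr0_norm ?invr_gt0//.
  have -> : y * y - y' * y' = y * (y - y') + (y - y') * y'.
    by rewrite mulrBr mulrBl addrA subrK.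
  have := rnormD (y * (y - y')) ((y - y') * y').
  have := rnormM y (y - y'); have := rnormM (y - y') y'.
  have := rnorm_ge0 (y - y'); nra.
have [||y yq yF] := @contraction_fixpoint F q q q01 q0.
- move=> y yq; rewrite rnormZr gtr0_norm ?invr_gt0//.
  have := rnormD x (y * y); have := rnormM y y; have := rnorm_ge0 y.
  rewrite -/q; move: x1; rewrite -/q; nra.
- exact: Fq.
(* [F] commutes with [star], so [star y] is another fixed point in the ball, and the contraction
   identifies it with [y]. *)
have sy : star y = y.
  have sF : F (star y) = star y by rewrite -{2}yF starZr starD starM sx.
  apply/eqP; rewrite -subr_eq0; apply/eqP/rnorm_eq0/eqP.
  rewrite eq_le rnorm_ge0 andbT.
  have := Fq (star y) y; rewrite sF yF rnorm_star => /(_ yq yq).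
  have := rnorm_ge0 (star y - y); move: x1; rewrite -/q; nra.
exists (1 - y); split.
- by rewrite starB star1 sy.
- have y2 : y + y = x + y * y.
    rewrite -{1 2}yF -scalerDl -rmorphD /=.
    by have -> : 2^-1 + 2^-1 = 1 :> R by [lra]; rewrite scale1r.
  have -> : x = y + (y - y * y) by rewrite addrA y2 addrK.
  by rewrite opprD addrA mulrBl mul1r mulrBr mulr1.
- by apply/inv_bound_invertible/inv_bound_1B; apply: le_lt_trans yq x1.
Qed.

End Inverse.

(** * Self-adjoint elements have real spectrum *)

Section SelfAdjointSpectrum.
Variables (R : realType) (A : cstarAlgType R).
Implicit Types a b c h k x y : A.
Implicit Types z w : R[i].
Implicit Types t u v : R.

Local Notation I v := (Complex 0 v).

Lemma rnormZi v x : rnorm (I v *: x) = `|v| * rnorm x.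
Proof. by rewrite rnormZ normc_def /= expr0n /= add0r sqrtr_sqr. Qed.

Lemma star_scalar t : star (t%:C *: (1 : A)) = t%:C *: (1 : A).
Proof. by rewrite starZr star1. Qed.

Lemma star_imag v : star (I v *: (1 : A)) = - (I v *: (1 : A)).
Proof.
rewrite starZ star1 -scaleNr; congr (_ *: _).
by apply/eqP; rewrite eq_complex /= oppr0 !eqxx.
Qed.

(* [(h + iv)(h - iv)^-1 = 1 + 2iv (h - iv)^-1] is unitary. *)
Lemma resolvent_norm h v b : star h = h -> v != 0 ->
  (h - I v *: (1 : A)) * b = 1 -> rnorm b <= `|v|^-1.
Proof.
move=> sh v0 hb; set w := I v *: (1 : A) in hb *.
have sw : star w = - w := star_imag v.
have bh : star b * (h + w) = 1.
  by have := congr1 (@star R A) hb; rewrite starM starB sh sw opprK star1.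
have hw : h * w = w * h by rewrite mulZr mulZl mulr1 mul1r.
have unit_U : star ((h + w) * b) * ((h + w) * b) = 1.
  rewrite starM starD sh sw -mulrA [(h - w) * _]mulrA.
  have -> : (h - w) * (h + w) = (h + w) * (h - w).
    rewrite mulrBl mulrDl !mulrDr !mulrN hw.
    by rewrite opprD addrA addrK addrA subrK.
  by rewrite -mulrA hb mulr1.
have U1 : rnorm ((h + w) * b) <= 1.
  have := rnorm_starM ((h + w) * b); rewrite unit_U => e.
  have := rnorm1_le1 A; have := rnorm_ge0 ((h + w) * b); nra.
(* Hence [w * b] is half the difference of two elements of norm at most 1. *)
have bE : I v *: b = 2^-1%:C *: ((h + w) * b - 1).
  have -> : I v *: b = w * b by rewrite mulZl mul1r.
  have -> : h + w = (h - w) + (w + w) by rewrite addrA subrK.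
  rewrite mulrDl hb [1 + _]addrC addrK mulrDl -mulr2n -scalerMnr scalerMnl.
  by rewrite -rmorphMn /= -mulr_natr mulVf ?scale1r// pnatr_eq0.
have : rnorm (I v *: b) <= 1.
  rewrite bE rnormZr ger0_norm ?invr_ge0//.
  have := rnormB ((h + w) * b) 1; have := rnorm1_le1 A; lra.
by rewrite rnormZi mulrC -ler_pdivlMr ?normr_gt0// mul1r.
Qed.

(** At height [3v/2] the inverse has norm at most [2/(3v)], and the move down by [v/2] costs [1/3],
    within the [1/2] allowed by [inv_boundD]. The ratio [3/2] does not depend on [v]. *)
Lemma resolvent_step h v : star h = h -> 0 < v ->
  invertible (h - I (v * (3 / 2)) *: (1 : A)) -> invertible (h - I v *: (1 : A)).
Proof.
move=> sh v0 [b [hb bh]]; have v3 : 0 < v * (3 / 2) by lra.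
have bv := resolvent_norm sh (lt0r_neq0 v3) hb; rewrite gtr0_norm// in bv.
have hI : inv_bound (h - I (v * (3 / 2)) *: (1 : A)) (v * (3 / 2))^-1 by exists b.
have -> : h - I v *: (1 : A) = h - I (v * (3 / 2)) *: (1 : A) + I (v / 2) *: (1 : A).
  rewrite -addrA; congr (_ + _); rewrite -!scaleNr -scalerDl; congr (_ *: _).
  by apply/eqP; rewrite eq_complex /= oppr0 addr0 eqxx /=; apply/eqP; lra.
apply: inv_bound_invertible (inv_boundD hI _).
rewrite rnormZi gtr0_norm ?divr_gt0// ler_pdivrMr//.
have := rnorm1_le1 A; nra.
Qed.

(** Above height [rnorm h] the Neumann series applies; [n] steps of ratio [3/2] then lead down to
    the given height. Negative heights are reached through [- h]. *)
Lemma invertible_imag h v : star h = h -> v != 0 -> invertible (h - I v *: (1 : A)).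
Proof.
have pos n : forall u h, star h = h -> 0 < u -> rnorm h < u * (3 / 2) ^+ n ->
    invertible (h - I u *: (1 : A)).
  elim: n => [|n ih] {}u {}h sh u0 hu.
    rewrite expr0 mulr1 in hu.
    have -> : h - I u *: (1 : A) = I (- 1) *: (u%:C *: (1 : A) - I (- 1) *: h).
      rewrite scalerBr !scalerA addrC; congr (_ + _); last rewrite -scaleNr.
        by rewrite -scaleNr; congr (_ *: _); apply/eqP;
           rewrite eq_complex /=; apply/andP; split; apply/eqP; lra.
      rewrite -[LHS]scale1r; congr (_ *: _).
      by apply/eqP; rewrite eq_complex /=; apply/andP; split; apply/eqP; lra.
    apply: invertibleZ; last first.
      by apply: invertible_scalarB; rewrite rnormZi normrN1 mul1r.
    by rewrite eq_complex /= eqxx oppr_eq0 oner_eq0.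
  apply: resolvent_step => //; apply: ih => //; first lra.
  by move: hu; rewrite exprS mulrA.
have big u x : 0 < u -> exists n, rnorm x < u * (3 / 2) ^+ n.
  move=> u0; have q01 : 0 <= (2 / 3 : R) < 1 by lra.
  have [N /(_ N (leqnn _)) hN] := expr_lt_eps (rnorm x) q01 u0.
  exists N; have -> : rnorm x = (3 / 2) ^+ N * ((2 / 3) ^+ N * rnorm x).
    rewrite mulrA -exprMn; have -> : 3 / 2 * (2 / 3) = 1 :> R by lra.
    by rewrite expr1n mul1r.
  by rewrite mulrC ltr_pM2r// exprn_gt0//; lra.
move=> sh; rewrite neq_lt => /orP[v0|v0]; last first.
  by have [n hn] := big _ h v0; exact: pos hn.
have v1 : 0 < - v by lra.
have [n hn] := big _ (- h) v1.
have sNh : star (- h) = - h by rewrite starN sh.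
have := invertibleN (pos n _ _ sNh v1 hn).
rewrite opprB opprK addrC -scaleNr.
suff -> : - I v = I (- v) by [].
by apply/eqP; rewrite eq_complex /= oppr0 !eqxx.
Qed.

Lemma inv_bound_imag h v : star h = h -> v != 0 ->
  inv_bound (h - I v *: (1 : A)) `|v|^-1.
Proof.
move=> sh v0; have [b [hb bh]] := invertible_imag sh v0.
by exists b; split=> //; exact: resolvent_norm hb.
Qed.

(** The real part [p] is absorbed in [h], which stays self-adjoint. *)
Lemma spectrum_real h p q : star h = h -> q != 0 ->
  invertible (h - (Complex p q) *: (1 : A)).
Proof.
move=> sh q0; have -> : Complex p q = p%:C + I q.
  by apply/eqP; rewrite eq_complex /= addr0 add0r !eqxx.
rewrite scalerDl opprD addrA; apply: invertible_imag => //.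
by rewrite starB sh star_scalar.
Qed.

End SelfAdjointSpectrum.

(** * The norm of a self-adjoint element is attained on its spectrum *)

Section SpectralRadius.
Variables (R : realType) (A : cstarAlgType R).
Implicit Types a b c h k x y : A.
Implicit Types z w : R[i].

Definition inverse_of a b := a * b = 1 /\ b * a = 1.

(** In the form [1 - z k], scaling [k] by [r] moves the circle to radius [r], and squaring [k] is
    matched by a square root of [z]. *)
Definition resolvent_close (k k' : A) (e : R) := forall z, `|z| = 1 ->
  exists b c, [/\ inverse_of (1 - z *: k) b, inverse_of (1 - z *: k') c &
    rnorm (b - c) <= e].

(** Partial fractions: [2/(1 - x^2) = 1/(1 - x) + 1/(1 + x)]. *)
Lemma inverse_of_1Bsqr x b c : inverse_of (1 - x) b -> inverse_of (1 + x) c ->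
  inverse_of (1 - x * x) (2^-1%:C *: (b + c)).
Proof.
have xx : (1 - x) * (1 + x) = 1 - x * x.
  by rewrite mulrBl mul1r mulrDr mulr1 opprD addrA addrK.
have xx' : (1 + x) * (1 - x) = 1 - x * x.
  by rewrite mulrDl mul1r mulrBr mulr1 addrA subrK.
have two : 2^-1%:C *: ((1 + x) + (1 - x)) = 1.
  rewrite addrA addrAC addrK -mulr2n -scalerMnr scalerMnl -rmorphMn /=.
  by rewrite -mulr_natr mulVf ?scale1r// pnatr_eq0.
move=> [xb bx] [xc cx]; split.
  by rewrite mulZr mulrDr -{1}xx' -xx -!mulrA xb xc !mulr1 two.
by rewrite mulZl mulrDl -{1}xx -xx' !mulrA bx cx !mul1r two.
Qed.

(* With [w ^+ 2 = z], the inverse of [1 - z k^2] is the mean of those of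
   [1 - w k] and [1 + w k], so squaring does not increase the distance. *)
Lemma resolvent_close_sqr k k' e : resolvent_close k k' e ->
  resolvent_close (k * k) (k' * k') e.
Proof.
move=> close z z1; set w := sqrtC z.
have ww : w * w = z by rewrite -expr2 sqrtCK.
have w1 : `|w| = 1.
  by apply/eqP; rewrite -(@eqrXn2 _ 2)// expr1n -normrX sqrtCK z1.
have Nw1 : `|- w| = 1 by rewrite normrN.
have sqrE x : z *: (x * x) = (w *: x) * (w *: x).
  by rewrite mulZl mulZr scalerA ww.
have [b [c [kb kc bc]]] := close w w1.
have [b' [c' [kb' kc' bc']]] := close (- w) Nw1.
rewrite scaleNr opprK in kb'; rewrite scaleNr opprK in kc'.
exists (2^-1%:C *: (b + b')), (2^-1%:C *: (c + c')); split.
- by rewrite sqrE; apply: inverse_of_1Bsqr.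
- by rewrite sqrE; apply: inverse_of_1Bsqr.
- rewrite -scalerBr rnormZr ger0_norm ?invr_ge0// opprD addrACA.
  have := rnormD (b - c) (b' - c'); lra.
Qed.

(** Up to a factor of modulus 1, [1 - z h] is [h - z^-1]. Let [q] be the imaginary part of [z^-1].
    If [|q|] is at least [1/(4K)], the bound [1/|q|] suffices; otherwise [z^-1] is so near [1] or
    [-1] that the inverse there can be perturbed. *)
Lemma unit_resolvent_bound h : star h = h ->
  invertible (h - 1) -> invertible (h + 1) ->
  exists2 K, 1 <= K & forall z, `|z| = 1 -> inv_bound (1 - z *: h) K.
Proof.
move=> sh /invertible_inv_bound[K1 K1_gt0 hK1].
move=> /invertible_inv_bound[K2 K2_gt0 hK2].
set K := K1 + K2 + 1.
have hK1' : inv_bound (h - 1) K by apply: inv_bound_le hK1; rewrite /K; lra.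
have hK2' : inv_bound (h + 1) K by apply: inv_bound_le hK2; rewrite /K; lra.
have K_gt1 : 1 < K by rewrite /K; lra.
exists (4 * K); first lra.
move=> z z1; have zn0 : z != 0 by rewrite -normr_gt0 z1.
have zi1 : `|z^-1| = 1 by rewrite normfV z1 invr1.
have -> : 1 - z *: h = (- z) *: (h - z^-1 *: (1 : A)).
  by rewrite scaleNr scalerBr scalerA divff// scale1r opprB.
suff /(@inv_boundZ _ _ _ _ (- z)) : inv_bound (h - z^-1 *: (1 : A)) (4 * K).
  by rewrite invrN normrN zi1 /= mul1r; apply; rewrite oppr_eq0.
case: z^-1 zi1 => p q; rewrite normc_def => -[pq1].
have {}pq1 : p ^+ 2 + q ^+ 2 = 1.
  rewrite -[RHS](expr1n _ 2) -pq1 sqr_sqrtr//.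
  by rewrite addr_ge0// sqr_ge0.
have pqE : Complex p q = p%:C + Complex 0 q.
  by apply/eqP; rewrite eq_complex /= addr0 add0r !eqxx.
have [qK|qK] := leP (4 * K)^-1 `|q|.
  have q0 : q != 0.
    by rewrite -normr_gt0; apply: lt_le_trans qK; rewrite invr_gt0; lra.
  rewrite pqE scalerDl opprD addrA.
  have sp : star (h - p%:C *: (1 : A)) = h - p%:C *: (1 : A).
    by rewrite starB sh star_scalar.
  apply: inv_bound_le (inv_bound_imag sp q0).
  by rewrite invf_ple ?posrE ?normr_gt0//; lra.
have qK' : `|q| * (4 * K) < 1 by rewrite -ltr_pdivlMr ?div1r//; lra.
have q2 : `|q| ^+ 2 = q ^+ 2 by rewrite real_normK// num_real.
have qge0 := normr_ge0 q.
have near1 (s : R) : `|s - p| <= `|q| -> inv_bound (h - s%:C *: (1 : A)) K ->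
    inv_bound (h - Complex p q *: (1 : A)) (4 * K).
  move=> sp hs.
  have -> : h - Complex p q *: (1 : A) = h - s%:C *: (1 : A) +
      ((s - p)%:C *: (1 : A) + Complex 0 (- q) *: (1 : A)).
    rewrite -!addrA; congr (_ + _); rewrite -!scaleNr -!scalerDl; congr (_ *: _).
    by apply/eqP; rewrite eq_complex /= addr0 addKr oppr0 !add0r !eqxx.
  apply: inv_bound_le (inv_boundD hs _); first lra.
  have N1 := rnorm1_le1 A.
  have le1 : rnorm ((s - p)%:C *: (1 : A)) <= `|q|.
    by rewrite rnormZr; apply: le_trans sp; rewrite ler_piMr.
  have le2 : rnorm (Complex 0 (- q) *: (1 : A)) <= `|q|.
    by rewrite rnormZi normrN ler_piMr.
  apply: le_trans (ler_wpM2r _ (rnormD _ _)) _; first lra.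
  by apply: le_trans (ler_wpM2r _ (lerD le1 le2)) _; lra.
(* On the unit circle with [p >= 0], [1 - p <= 1 - p^2 = q^2 <= |q|]; symmetrically for [p < 0]. *)
have [p0|p0] := leP 0 p.
  apply: (near1 1); last by rewrite scale1r.
  rewrite ger0_norm; nra.
apply: (near1 (- 1)); last by rewrite rmorphN /= scaleN1r opprK.
rewrite ler0_norm; nra.
Qed.

(** For self-adjoint [k] the C*-identity reads [|k^2| = |k|^2]. *)
Lemma rnorm_iter_sqr_sa m h : star h = h -> rnorm h = 1 ->
  rnorm (iter m (fun x => x * x) h) = 1.
Proof.
move=> sh h1.
suff [] : star (iter m (fun x => x * x) h) = iter m (fun x => x * x) h /\
  rnorm (iter m (fun x => x * x) h) = 1 by [].
elim: m => [//|m [ih1 ih2]] /=; set k := iter _ _ _ in ih1 ih2 *; split.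
  by rewrite starM ih1.
by rewrite -{1}ih1 rnorm_starM ih2 expr1n.
Qed.

Lemma rnorm_iter_sqr_le m x : rnorm (iter m (fun x => x * x) x) <= rnorm x ^+ (2 ^ m).
Proof.
elim: m => [|m ih]; first by rewrite expr1.
rewrite expnS mulnC exprM expr2 iterS; apply: le_trans (rnormM _ _) _.
by apply: ler_pM => //; exact: rnorm_ge0.
Qed.

(** The resolvents of [h] and [(1 - d) h] are [1/8]-close on the circle, and remain so under
    repeated squaring. But the powers of [h] keep norm 1 while those of [(1 - d) h] become small,
    which is contradictory at [z = 1]. *)
Lemma sa_unit_spectrum h : star h = h -> rnorm h = 1 ->
  invertible (h - 1) -> invertible (h + 1) -> False.
Proof.
move=> sh h1 hm hp; have [K K1 hK] := unit_resolvent_bound sh hm hp.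
(* The two inverses, of norm at most [K] and [2K], differ by at most [K * d * 2K = 1/8]. *)
pose d : R := (16 * K ^+ 2)^-1.
have dK : d * (16 * K ^+ 2) = 1 by rewrite mulVf// gt_eqF//; nra.
have d0 : 0 < d by rewrite invr_gt0; nra.
have d1 : d < 1 by nra.
have close0 : resolvent_close h ((1 - d)%:C *: h) 8^-1.
  move=> z z1; have [b [xb bx bK]] := hK z z1.
  have zE : 1 - z *: ((1 - d)%:C *: h) = 1 - z *: h + d%:C *: (z *: h).
    rewrite rmorphB /= scalerBl scale1r scalerBr opprB addrA.
    by rewrite addrAC !scalerA mulrC.
  have nz : rnorm (d%:C *: (z *: h)) = d.
    by rewrite rnormZr rnormZ z1 h1 !mulr1 gtr0_norm.
  have [|c [yc cy cK]] := inv_boundD (hK z z1) (d := d%:C *: (z *: h)).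
    by rewrite nz; nra.
  rewrite -zE in yc cy.
  exists b, c; split=> //.
  have -> : b - c = b * (d%:C *: (z *: h)) * c.
    have -> : d%:C *: (z *: h) = 1 - z *: ((1 - d)%:C *: h) - (1 - z *: h).
      by rewrite zE addrAC subrr add0r.
    by rewrite mulrBr bx mulrBl -mulrA yc mulr1 mul1r.
  have := rnormM (b * (d%:C *: (z *: h))) c; have := rnormM b (d%:C *: (z *: h)).
  rewrite nz; have := rnorm_ge0 c; have := rnorm_ge0 b.
  set bd := rnorm (b * _); set r := rnorm (_ * c) => b0 c0 le1 le2.
  have : bd <= K * d by nra.
  have : 0 <= bd by exact: rnorm_ge0.
  nra.
have q01 : 0 <= 1 - d < 1 by lra.
have e0 : 0 < 8^-1 :> R by lra.
have [m hm8] := expr_lt_eps 1 q01 e0.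
have {}hm8 : (1 - d) ^+ (2 ^ m) <= 8^-1.
  by have := hm8 _ (ltnW (ltn_expl m (isT : (1 < 2)%N))); rewrite mulr1 => /ltW.
have close : forall n, resolvent_close (iter n (fun x => x * x) h)
    (iter n (fun x => x * x) ((1 - d)%:C *: h)) 8^-1.
  by elim=> [//|n ih] /=; apply: resolvent_close_sqr.
have [b [c [[kb bk] [kc ck] bc]]] := close m 1 (normr1 _).
rewrite !scale1r in kb bk kc ck.
have k1 := rnorm_iter_sqr_sa m sh h1.
have k'8 : rnorm (iter m (fun x => x * x) ((1 - d)%:C *: h)) <= 8^-1.
  apply: le_trans (rnorm_iter_sqr_le _ _) _.
  by rewrite rnormZr h1 mulr1 ger0_norm//; lra.
set k := iter m _ h in kb bk k1; set k' := iter m _ _ in kc ck k'8.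
have N1 := rnorm1_le1 A.
(* From [|k'| <= 1/8], [|c - 1| <= 1/7], so [|b - 1| <= 1/8 + 1/7 = 15/56]. Then
   [k = (b - 1)(1 - k)] has norm at most [30/56], against [|k| = 1]. *)
have cE : c - 1 = k' * c by rewrite -kc mulrBl mul1r opprB addrC subrK.
have c1 : rnorm (c - 1) <= 1 / 7.
  have := rnormD (c - 1) 1; rewrite subrK => h2.
  have := rnormM k' c; rewrite -cE; have := rnorm_ge0 c; nra.
have b1 : rnorm (b - 1) <= 15 / 56 by have := rdistD c b 1; lra.
have kE : k = (b - 1) * (1 - k) by rewrite mulrBl bk mul1r opprB addrC subrK.
have := rnormM (b - 1) (1 - k); rewrite -kE k1.
have := rnormB 1 k; rewrite k1; have := rnorm_ge0 (b - 1).
have := rnorm_ge0 (1 - k); nra.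
Qed.

Lemma sa_spectrum_norm h : star h = h -> 0 < rnorm h ->
  invertible ((rnorm h)%:C *: (1 : A) - h) ->
  invertible ((rnorm h)%:C *: (1 : A) + h) -> False.
Proof.
move=> sh; set r := rnorm h => r0 hm hp.
have rn0 : r%:C != 0 by rewrite -[0]/(0%:C) (inj_eq (@complexI R)) gt_eqF.
have rV : r^-1%:C * r%:C = 1 by rewrite fmorphV mulVf.
have rVn0 : r^-1%:C != 0 by rewrite fmorphV invr_eq0.
apply: (@sa_unit_spectrum (r^-1%:C *: h)).
- by rewrite starZr sh.
- by rewrite rnormZr gtr0_norm ?invr_gt0// mulVf// gt_eqF.
- have := invertibleN (invertibleZ rVn0 hm).
  by rewrite scalerBr scalerA rV scale1r opprB.
- by have := invertibleZ rVn0 hp; rewrite scalerDr scalerA rV scale1r addrC.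
Qed.

End SpectralRadius.

(** * The positive cone, its order, and square roots *)

Section PositiveCone.
Variables (R : realType) (A : cstarAlgType R).
Implicit Types a b c x y : A.
Implicit Types t u e : R.

(** The spectrum being real, only negative reals remain to be excluded. *)
Lemma cstar_posI a : star a = a ->
  (forall t, 0 < t -> invertible (a + t%:C *: (1 : A))) -> cstar_pos a.
Proof.
move=> sa inva; split=> // -[p q] sp.
have [q0|/(spectrum_real p sa)/sp//] := eqVneq q 0; rewrite {}q0 in sp *.
rewrite ler0c; have [//|p0] := leP 0 p; case: sp.
have := inva (- p); rewrite oppr_gt0 rmorphN /= scaleNr; exact.
Qed.

Lemma cstar_pos_shift a t : cstar_pos a -> 0 < t -> invertible (a + t%:C *: (1 : A)).
Proof.
move=> [_ spa] t0; apply: contrapT => h.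
have /spa : spectrum a (- t%:C) by rewrite /spectrum /= scaleNr opprK.
by rewrite -rmorphN ler0c; lra.
Qed.

(** If [h = t - a] had norm above [t], then [|h| - h = a + (|h| - t)] would be invertible by
    positivity and [|h| + h = (|h| + t) - a] by the Neumann series, contradicting
    [sa_spectrum_norm]. *)
Lemma cstar_pos_rnorm a t : cstar_pos a -> rnorm a <= t ->
  rnorm (t%:C *: (1 : A) - a) <= t.
Proof.
move=> pa at_; have t0 : 0 <= t := le_trans (rnorm_ge0 a) at_.
rewrite leNgt; apply/negP; set h := _ - a => th.
have sh : star h = h by rewrite starB star_scalar pa.1.
apply: (sa_spectrum_norm sh); first exact: le_lt_trans th.
- have -> : (rnorm h)%:C *: (1 : A) - h = a + (rnorm h - t)%:C *: (1 : A).
    by rewrite rmorphB /= scalerBl /h opprB [RHS]addrC addrA addrAC.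
  by apply: cstar_pos_shift => //; rewrite subr_gt0.
- have -> : (rnorm h)%:C *: (1 : A) + h = (rnorm h + t)%:C *: (1 : A) - a.
    by rewrite rmorphD /= scalerDl -addrA.
  by apply: invertible_scalarB; lra.
Qed.

(** Converse of [cstar_pos_rnorm]: [a + u = (t + u) - (t - a)] is invertible by the Neumann
    series. *)
Lemma rnorm_cstar_pos a t : star a = a -> rnorm (t%:C *: (1 : A) - a) <= t ->
  cstar_pos a.
Proof.
move=> sa at_; apply: cstar_posI => // u u0.
have -> : a + u%:C *: (1 : A) = (t + u)%:C *: (1 : A) - (t%:C *: (1 : A) - a).
  by rewrite rmorphD /= scalerDl opprB [RHS]addrC addrA subrK.
by apply: invertible_scalarB; lra.
Qed.

(** The norm criterion turns this into the triangle inequality. *)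
Lemma cstar_posD a b : cstar_pos a -> cstar_pos b -> cstar_pos (a + b).
Proof.
move=> pa pb; apply: (@rnorm_cstar_pos _ (rnorm a + rnorm b)).
  by rewrite starD pa.1 pb.1.
rewrite rmorphD /= scalerDl opprD addrACA.
apply: le_trans (rnormD _ _) (lerD _ _); exact: cstar_pos_rnorm.
Qed.

Lemma cstar_pos_scalar t : 0 <= t -> cstar_pos (t%:C *: (1 : A)).
Proof.
move=> t0; apply: (@rnorm_cstar_pos _ t); first exact: star_scalar.
by rewrite subrr rnorm0.
Qed.

Lemma cstar_pos0 : cstar_pos (0 : A).
Proof. by have := cstar_pos_scalar (lexx 0); rewrite scale0r. Qed.

Lemma cstar_posZ t a : 0 <= t -> cstar_pos a -> cstar_pos (t%:C *: a).
Proof.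
move=> t0 pa; apply: (@rnorm_cstar_pos _ (t * rnorm a)).
  by rewrite starZr pa.1.
rewrite rmorphM /= -scalerA -scalerBr rnormZr ger0_norm//.
by rewrite ler_wpM2l// cstar_pos_rnorm.
Qed.

Lemma cstar_pos_closed a :
  (forall e, 0 < e -> exists2 b, cstar_pos b & rnorm (a - b) <= e) ->
  cstar_pos a.
Proof.
move=> h; apply: (@rnorm_cstar_pos _ (rnorm a + 1)).
  apply/eqP; rewrite -subr_eq0; apply/eqP/rnorm_eq0/eqP.
  rewrite eq_le rnorm_ge0 andbT; apply/ler_addgt0Pr => e e0; rewrite add0r.
  have [|b pb ab] := h (e / 2); first lra.
  have := rdistD b (star a) a; rewrite -{1}pb.1 -starB rnorm_star (rdistC b); lra.
apply/ler_addgt0Pr => e e0.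
(* Errors at most 1 let the same [t = rnorm a + 1] serve in the norm criterion for every
   approximant. *)
have [|b pb ab] := h (Num.min e 1); first by rewrite lt_min e0 ltr01.
have ab1 : rnorm (a - b) <= 1 by apply: le_trans ab _; rewrite ge_min lexx orbT.
have abe : rnorm (a - b) <= e by apply: le_trans ab _; rewrite ge_min lexx.
have b1 : rnorm b <= rnorm a + 1.
  by have := rdistD a b 0; rewrite !subr0 (rdistC b); lra.
have := rdistD b ((rnorm a + 1)%:C *: (1 : A)) a.
have := cstar_pos_rnorm pb b1; rewrite (rdistC b a); lra.
Qed.

(** As [a <= b <= |b|], having [|b| < |a|] would make both [|a| - a] and [|a| + a] invertible. *)
Lemma cstar_le_rnorm a b : cstar_pos a -> cstar_le a b -> rnorm a <= rnorm b.
Proof.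
move=> pa ab; rewrite leNgt; apply/negP => ba.
have pb : cstar_pos b by rewrite -(subrK a b); exact: cstar_posD.
have bb : cstar_pos ((rnorm b)%:C *: (1 : A) - b).
  apply: (@rnorm_cstar_pos _ (rnorm b)).
    by rewrite starB star_scalar pb.1.
  by rewrite opprB addrC subrK.
have ba' : cstar_pos ((rnorm b)%:C *: (1 : A) - a).
  by have := cstar_posD bb ab; rewrite addrA subrK.
apply: (sa_spectrum_norm pa.1); first exact: le_lt_trans (rnorm_ge0 b) ba.
- have ab0 : 0 < rnorm a - rnorm b by rewrite subr_gt0.
  have := cstar_pos_shift ba' ab0.
  by rewrite rmorphB /= scalerBl addrC addrA subrK.
- rewrite addrC; apply: cstar_pos_shift => //.
  exact: le_lt_trans (rnorm_ge0 b) ba.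
Qed.

(** The spectrum of [b] avoids a ball of radius [g] about 0. With [z^2 = g^2 - u], factor
    [b^2 - z^2 = (b - z)(b + z)]: a real [z] satisfies [|z| <= g], and a nonzero imaginary [z] is
    off the spectrum. *)
Lemma cstar_pos_sqr_shift b : star b = b -> invertible b ->
  exists2 d : R, 0 < d & cstar_pos (b * b - d%:C *: (1 : A)).
Proof.
move=> sb ib; have [K K0 bK] := invertible_inv_bound ib.
pose g := (2 * K)^-1; have g0 : 0 < g by rewrite invr_gt0; lra.
have gK : g * K = 1 / 2 by rewrite /g invfM mulrAC -mulrA mulfV ?gt_eqF// mulr1 div1r.
exists (g ^+ 2); first exact: exprn_gt0.
have factor z : invertible (b - z *: (1 : A)) -> invertible (b - (- z) *: (1 : A)) ->
    invertible (b * b - (z ^+ 2) *: (1 : A)).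
  move=> bm bp; have := invertibleM bm bp; congr invertible.
  rewrite scaleNr opprK mulrBl !mulrDr !mulZr !mulZl !mulr1 !mul1r scalerA -expr2.
  by rewrite opprD addrA addrK.
apply: cstar_posI; first by rewrite starB starM sb star_scalar.
move=> u u0; have -> : b * b - (g ^+ 2)%:C *: (1 : A) + u%:C *: (1 : A) =
    b * b - (g ^+ 2 - u)%:C *: (1 : A).
  by rewrite rmorphB /= scalerBl opprB addrA addrAC.
have [ug|ug] := leP u (g ^+ 2).
  pose s := Num.sqrt (g ^+ 2 - u).
  have sE : s ^+ 2 = g ^+ 2 - u by rewrite sqr_sqrtr// subr_ge0.
  have s0 : 0 <= s by exact: sqrtr_ge0.
  have sg : s <= g by rewrite -(@ler_pXn2r _ 2)// ?nnegrE ?ltW// sE; lra.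
  have inv_near v : `|v| <= g -> invertible (b - v%:C *: (1 : A)).
    move=> vg; apply: inv_bound_invertible (inv_boundD bK _).
    rewrite rnormN -[leRHS]gK ler_pM2r// rnormZr.
    by apply: le_trans vg; rewrite ler_piMr// rnorm1_le1.
  rewrite -sE rmorphXn /=; apply: factor.
    by apply: inv_near; rewrite ger0_norm.
  by rewrite -rmorphN; apply: inv_near; rewrite normrN ger0_norm.
pose s := Num.sqrt (u - g ^+ 2).
have s0 : 0 < s by rewrite sqrtr_gt0 subr_gt0.
have -> : (g ^+ 2 - u)%:C = (Complex 0 s) ^+ 2.
  apply/eqP; rewrite eq_complex /= !mul0r mulr0 addr0 eqxx andbT sub0r -expr2.
  by rewrite sqr_sqrtr ?opprB// subr_ge0 ltW.
apply: factor; first by apply: invertible_imag; rewrite ?gt_eqF.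
have -> : - Complex 0 s = Complex 0 (- s).
  by apply/eqP; rewrite eq_complex /= oppr0 !eqxx.
by apply: invertible_imag => //; rewrite oppr_eq0 gt_eqF.
Qed.

(** With [b] the inverse of [c], [c a c + t = c (a + t b^2) c], and [b^2 >= d > 0] makes the middle
    factor a positive element plus [t d], hence invertible. *)
Lemma cstar_pos_conj c a : star c = c -> invertible c -> cstar_pos a ->
  cstar_pos (c * a * c).
Proof.
move=> sc ic pa; have [b [cb bc]] := ic.
have sb := star_invertible_inv sc cb bc.
have [|d d0 pd] := cstar_pos_sqr_shift sb; first by exists c.
apply: cstar_posI; first by rewrite !starM sc pa.1 mulrA.
move=> t t0; have -> : c * a * c + t%:C *: (1 : A) =
    c * (a + t%:C *: (b * b - d%:C *: (1 : A)) + (t * d)%:C *: (1 : A)) * c.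
  rewrite scalerBr scalerA -rmorphM /= addrA subrK mulrDr mulrDl; congr (_ + _).
  by rewrite mulZr mulZl mulrA cb mul1r bc.
apply: (invertibleM _ ic); apply: (invertibleM ic).
apply: cstar_pos_shift; last exact: mulr_gt0.
by apply: cstar_posD pa (cstar_posZ _ pd); exact: ltW.
Qed.

(** [a + e = t (1 - x)] with [t = |a| + e] and [x = (|a| - a) / t]; the shift by [e] makes the norm
    of [x] strictly less than 1. *)
Lemma cstar_pos_sqrt_shift a e : cstar_pos a -> 0 < e ->
  exists c, [/\ star c = c, invertible c & c * c = a + e%:C *: (1 : A)].
Proof.
move=> pa e0; set n := rnorm a; have n0 : 0 <= n := rnorm_ge0 a.
pose t := n + e; have t0 : 0 < t by rewrite /t; lra.
pose x := t^-1%:C *: (n%:C *: (1 : A) - a).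
have sx : star x = x by rewrite starZr starB star_scalar pa.1.
have x1 : rnorm x < 1.
  rewrite rnormZr gtr0_norm ?invr_gt0// mulrC ltr_pdivrMr// mul1r.
  by apply: le_lt_trans (cstar_pos_rnorm pa (lexx _)) _; rewrite /t -/n; lra.
have [s [ss s2 is_]] := sqrt_1B sx x1.
have tn : t%:C != 0 by rewrite -[0]/(0%:C) (inj_eq (@complexI R)) gt_eqF.
exists ((Num.sqrt t)%:C *: s); split.
- by rewrite starZr ss.
- apply: invertibleZ is_.
  by rewrite -[0]/(0%:C) (inj_eq (@complexI R)) gt_eqF// sqrtr_gt0.
- rewrite mulZl mulZr scalerA -rmorphM /= -expr2 sqr_sqrtr ?ltW// s2.
  rewrite scalerBr scalerA -rmorphM /= divff ?gt_eqF// scale1r opprB addrCA.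
  by rewrite rmorphD /= scalerDl addrAC subrr add0r.
Qed.

(** The bridge from norm bounds to the order of [A]; the conjugates come from replacing [x] by
    [act b x] in a module. *)
Lemma cstar_le_of_conj_norm (p q : A) (C : R) : 0 <= C ->
  star p = p -> cstar_pos q ->
  (forall b, rnorm (b * p * star b) <= C * rnorm (b * q * star b)) ->
  cstar_le p (C%:C *: q).
Proof.
move=> C0 sp pq pqC; apply: cstar_pos_closed => e e0.
pose d := e / (C + 1); have d0 : 0 < d by rewrite divr_gt0//; lra.
have dE : d * (C + 1) = e by rewrite mulfVK// gt_eqF//; lra.
have [c [sc ic cc]] := cstar_pos_sqrt_shift pq d0.
(* Since [c * c = q + d], this differs from [C q - p] by [C d], which is at most [e] by the choice
   of [d]. *)
exists (C%:C *: (c * c) - p); last first.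
  rewrite opprB addrA subrK cc scalerDr opprD addrA subrr add0r.
  rewrite rnormN scalerA -rmorphM /= rnormZr ger0_norm; last nra.
  apply: le_trans (ler_piMr _ (rnorm1_le1 A)) _; first exact: mulr_ge0 (ltW d0).
  by rewrite -dE mulrC ler_pM2l//; lra.
have [b [cb bc]] := ic.
have sb := star_invertible_inv sc cb bc.
have ib : invertible b by exists c.
have pb : cstar_pos (b * q * b) by exact: cstar_pos_conj.
have b1 : rnorm (b * q * b) <= 1.
  apply: le_trans (rnorm1_le1 A); apply: cstar_le_rnorm => //.
  (* Conjugating [c * c = q + d] by [b] gives [1 = b q b + d b^2]. *)
  rewrite /cstar_le; have -> : 1 - b * q * b = d%:C *: (b * 1 * b).
    have one : 1 = b * (c * c) * b by rewrite mulrA bc mul1r cb.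
    by rewrite {1}one cc mulrDr mulrDl addrC addrA addNr add0r mulZr mulZl.
  apply: cstar_posZ; first exact: ltW.
  apply: cstar_pos_conj => //.
  by have := cstar_pos_scalar ler01; rewrite scale1r.
have bp : rnorm (b * p * b) <= C.
  by have := pqC b; rewrite sb; nra.
have : cstar_pos (C%:C *: (1 : A) - b * p * b).
  apply: (@rnorm_cstar_pos _ C); last by rewrite opprB addrC subrK.
  by rewrite starB star_scalar !starM sb sp mulrA.
move=> /(cstar_pos_conj sc ic); congr cstar_pos.
rewrite mulrBr mulrBl mulZr mulZl mulr1; congr (_ - _).
by rewrite !mulrA cb mul1r -mulrA bc mulr1.
Qed.

End PositiveCone.

(** * Inner products and adjointable operators *)

Section Modules.
Variables (R : realType) (A : cstarAlgType R) (H : hilbertModType A).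
Implicit Types x y z : H.
Implicit Types a b : A.
Implicit Types T U : H -> H.

Local Notation inner x y := (inner x y : A).

Lemma inner0l y : inner 0 y = 0.
Proof. by apply: (addrI (inner 0 y)); rewrite -innerDl !addr0. Qed.

Lemma innerNl x y : inner (- x) y = - inner x y.
Proof. by apply: (addrI (inner x y)); rewrite -innerDl !subrr inner0l. Qed.

Lemma innerDr x y z : inner x (y + z) = inner x y + inner x z.
Proof.
by rewrite (inner_star x (y + z)) innerDl starD -!(inner_star x).
Qed.

Lemma innerNr x y : inner x (- y) = - inner x y.
Proof. by rewrite (inner_star x (- y)) innerNl starN -inner_star. Qed.

Lemma inner_inj x y : (forall z, inner x z = inner y z) -> x = y.
Proof.
move=> xy; apply/eqP; rewrite -subr_eq0; apply/eqP/(inner_eq0 (A := A)).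
by rewrite innerDl innerNl xy subrr.
Qed.

Lemma adjointable_act T a x : adjointable T -> T (act a x) = act a (T x).
Proof.
by move=> [T' TT']; apply: inner_inj => z; rewrite TT' !inner_act TT'.
Qed.

Lemma adjointableD T U : adjointable T -> adjointable U ->
  adjointable (fun x => T x + U x).
Proof.
move=> [T' TT'] [U' UU']; exists (fun x => T' x + U' x) => x y.
by rewrite innerDl innerDr TT' UU'.
Qed.

Lemma adjointable_sum (I : Type) (r : seq I) (V : I -> H -> H) :
  (forall i, adjointable (V i)) -> adjointable (fun x => \sum_(i <- r) V i x).
Proof.
move=> adjV; elim: r => [|i r ih].
  by exists (fun=> 0) => x y; rewrite big_nil inner0l (inner_star x) inner0l star0.
have := adjointableD (adjV i) ih; congr adjointable.
by apply/funext => x; rewrite big_cons.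
Qed.

Lemma inner_act_act a x : inner (act a x) (act a x) = a * inner x x * star a.
Proof.
by rewrite inner_act (inner_star x (act a x)) inner_act starM -inner_star mulrA.
Qed.

(** Dropping the positive second summand bounds the square of [x + y] in the order of [A], as
    [ell2D] requires. *)
Lemma parallelogram x y : inner (x + y) (x + y) + inner (x - y) (x - y) =
  (inner x x + inner y y) + (inner x x + inner y y).
Proof.
have -> : inner (x + y) (x + y) =
    inner x x + inner y y + (inner x y + inner y x).
  by rewrite innerDl !innerDr [inner y x + _]addrC addrACA.
have -> : inner (x - y) (x - y) =
    inner x x + inner y y - (inner x y + inner y x).
  rewrite innerDl innerNl !innerDr !innerNr !opprD opprK.
  by rewrite [- inner y x + _]addrC addrACA.
by rewrite addrACA subrr addr0.
Qed.

(** * Series of positive elements *)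

Variable J : set nat.
Implicit Types f g : J -> A.
Implicit Types s : A.

Lemma summable_cvg f : summable f -> (partial_sum f @ \oo --> series_sum f)%classic.
Proof. by []. Qed.

Lemma cvg_series_sum f s : (partial_sum f @ \oo --> s)%classic ->
  summable f /\ series_sum f = s.
Proof.
move=> fs; split; first by apply/cvg_ex; exists s.
by apply: cvg_lim => //; exact: norm_hausdorff.
Qed.

Lemma partial_sumD f g n :
  partial_sum (fun i => f i + g i) n = partial_sum f n + partial_sum g n.
Proof.
rewrite -big_split; apply: eq_bigr => i _ /=.
by case: insub => //=; rewrite addr0.
Qed.

Lemma series_sumD f g : summable f -> summable g ->
  summable (fun i => f i + g i) /\
  series_sum (fun i => f i + g i) = series_sum f + series_sum g.
Proof.
move=> sf sg; apply: cvg_series_sum.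
rewrite (_ : partial_sum _ = partial_sum f \+ partial_sum g).
  exact: cvgD.
by apply/funext => n; exact: partial_sumD.
Qed.

Lemma series_sum_conj f a : summable f ->
  series_sum (fun i => a * f i * star a) = a * series_sum f * star a.
Proof.
move=> /summable_cvg /rnorm_cvgP sf; apply: (cvg_series_sum _).2.
have pE n : partial_sum (fun i => a * f i * star a) n = a * partial_sum f n * star a.
  rewrite /partial_sum mulr_sumr mulr_suml; apply: eq_bigr => i _.
  by case: insub => //=; rewrite mulr0 mul0r.
apply/rnorm_cvgP => e e0; pose K := rnorm a; have K0 : 0 <= K := rnorm_ge0 a.
(* Conjugation by [a] multiplies errors by at most [K ^+ 2]; the [+ 1] covers [a = 0]. *)
pose d := e / (K ^+ 2 + 1); have Kd : 0 < K ^+ 2 + 1 by nra.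
have [|N hN] := sf d; first exact: divr_gt0.
exists N => n /hN lt; rewrite pE -mulrBl -mulrBr.
apply: le_lt_trans (rnormM _ _) _; rewrite rnorm_star -/K.
have le1 := rnormM a (series_sum f - partial_sum f n); rewrite -/K in le1.
have dE : d * (K ^+ 2 + 1) = e by rewrite mulfVK// gt_eqF.
apply: le_lt_trans (ler_wpM2r K0 le1) _.
have d0 : 0 < d by exact: divr_gt0.
set r := rnorm _ in lt *.
have : r * K ^+ 2 <= d * K ^+ 2 by rewrite ler_wpM2r ?sqr_ge0// ltW.
nra.
Qed.

Lemma partial_sum_subr_pos f m n : (forall i, cstar_pos (f i)) -> (m <= n)%N ->
  cstar_pos (partial_sum f n - partial_sum f m).
Proof.
move=> pf; elim: n => [|n ih].
  by rewrite leqn0 => /eqP->; rewrite subrr; exact: cstar_pos0.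
rewrite leq_eqVlt => /orP[/eqP->|]; first by rewrite subrr; exact: cstar_pos0.
move=> /ih pn; rewrite {1}/partial_sum big_ord_recr /= addrAC.
apply: cstar_posD pn _.
by case: insub => [i|] /=; [exact: pf|exact: cstar_pos0].
Qed.

Lemma series_sum_pos f : (forall i, cstar_pos (f i)) -> summable f ->
  cstar_pos (series_sum f).
Proof.
move=> pf /summable_cvg /rnorm_cvgP sf; apply: cstar_pos_closed => e e0.
have [N /(_ N (leqnn _))/ltW hN] := sf e e0; exists (partial_sum f N) => //.
have := partial_sum_subr_pos pf (leq0n N).
by rewrite [X in _ - X]big_ord0 subr0.
Qed.

(** Blocks of partial sums of [f] lie below those of [g] in [A], so monotonicity of the norm
    transfers the Cauchy property. The sums compare because the cone is closed. *)
Lemma summable_le f g : (forall i, cstar_pos (f i)) ->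
  (forall i, cstar_le (f i) (g i)) -> summable g ->
  summable f /\ rnorm (series_sum f) <= rnorm (series_sum g).
Proof.
move=> pf fg sg.
pose h i := g i - f i; have gE : g = (fun i => f i + h i).
  by apply/funext => i; rewrite addrC subrK.
have ph i : cstar_pos (h i) by exact: fg.
clearbody h.
have sf : summable f.
  apply: rnorm_cauchy => e e0; have /rnorm_cvgP/(_ (e / 2)) := summable_cvg sg.
  case=> [|N hN]; first lra.
  exists N => m n Nm mn.
  have gm := hN m Nm; have gn := hN n (leq_trans Nm mn).
  have := rdistD (series_sum g) (partial_sum g n) (partial_sum g m).
  rewrite (rdistC (partial_sum g n) (series_sum g)).
  suff : rnorm (partial_sum f n - partial_sum f m) <=
         rnorm (partial_sum g n - partial_sum g m) by lra.
  apply: cstar_le_rnorm; first exact: partial_sum_subr_pos.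
  have := partial_sum_subr_pos ph mn; rewrite /cstar_le.
  suff -> : partial_sum g n - partial_sum g m -
      (partial_sum f n - partial_sum f m) = partial_sum h n - partial_sum h m by [].
  by rewrite gE !partial_sumD opprD addrACA [_ + (partial_sum h n - _)]addrC addrK.
split=> //; apply: cstar_le_rnorm; first exact: series_sum_pos.
apply: cstar_pos_closed => e e0.
have /rnorm_cvgP/(_ (e / 2)) := summable_cvg sg; case=> [|N hN]; first lra.
have /rnorm_cvgP/(_ (e / 2)) := summable_cvg sf; case=> [|M hM]; first lra.
pose n := maxn N M; exists (partial_sum h n).
  by have := partial_sum_subr_pos ph (leq0n n); rewrite [X in _ - X]big_ord0 subr0.
have -> : partial_sum h n = partial_sum g n - partial_sum f n.
  by rewrite gE partial_sumD addrC addrA addNr add0r.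
rewrite opprD addrACA -opprD.
have := rnormB (series_sum g - partial_sum g n) (series_sum f - partial_sum f n).
have := hN n (leq_maxl _ _); have := hM n (leq_maxr _ _); lra.
Qed.

(** * Square-summable families and Bessel bounds *)

Lemma sqnorm_pos (x : J -> H) i : cstar_pos (sqnorm x i).
Proof. exact: inner_pos. Qed.

Lemma ell2D (x y : J -> H) : ell2 x -> ell2 y ->
  ell2 (fun i => x i + y i) /\
  rnorm (series_sum (sqnorm (fun i => x i + y i))) <=
    2 * (rnorm (series_sum (sqnorm x)) + rnorm (series_sum (sqnorm y))).
Proof.
move=> ex ey; pose p i : A := sqnorm x i + sqnorm y i.
have [sp pE] := series_sumD ex ey; have [spp ppE] := series_sumD sp sp.
have le i : cstar_le (sqnorm (fun i => x i + y i) i) (p i + p i).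
  rewrite /cstar_le /p /sqnorm -parallelogram /= addrAC subrr add0r.
  exact: inner_pos.
have [sxy] := summable_le (@sqnorm_pos _) le spp.
rewrite ppE pE => sum_le; split=> //.
have := rnormD (series_sum (sqnorm x)) (series_sum (sqnorm y)).
set s := series_sum _ + series_sum _ in sum_le * => s1.
have := rnormD s s; lra.
Qed.

(** The upper frame bound in norm only, a form stable under sums and negation. *)
Definition bessel (V : J -> H -> H) := exists2 C : R, 0 < C &
  forall x, ell2 (V^~ x) /\
    rnorm (series_sum (sqnorm (V^~ x))) <= C * rnorm (inner x x).

Lemma besselD (V W : J -> H -> H) : bessel V -> bessel W ->
  bessel (fun i x => V i x + W i x).
Proof.
move=> [B B0 VB] [C C0 WC]; exists (2 * (B + C)); first lra.
move=> x; have [Vx Vle] := VB x; have [Wx Wle] := WC x.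
have [VWx VWle] := ell2D Vx Wx; split=> //.
by apply: le_trans VWle _; nra.
Qed.

Lemma bessel_sum (I : Type) (r : seq I) (V : I -> J -> H -> H) :
  (forall n, bessel (V n)) -> bessel (fun i x => \sum_(n <- r) V n i x).
Proof.
move=> bV; elim: r => [|n r ih].
  exists 1 => // x.
  have s0 n : partial_sum (sqnorm (fun=> 0 : H)) n = 0 :> A.
    apply: big1 => i _; case: insub => //= j; exact: inner0l.
  have [|e0 s0'] := @cvg_series_sum (sqnorm (fun=> 0 : H)) 0.
    by apply/rnorm_cvgP => e e0; exists 0%N => n _; rewrite s0 subrr rnorm0.
  have -> : (fun i : J => \sum_(n <- [::]) V n i x) = (fun=> 0).
    by apply/funext => i; rewrite big_nil.
  by split; rewrite ?s0' ?rnorm0 ?mul1r ?rnorm_ge0.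
have := besselD (bV n) ih; congr bessel.
by apply/funext => i; apply/funext => x; rewrite big_cons.
Qed.

Lemma besselN (V : J -> H -> H) : bessel V -> bessel (fun i x => - V i x).
Proof.
move=> [C C0 VC]; exists C => // x; have := VC x; rewrite /ell2 /=.
have -> : sqnorm (fun i => - V i x) = sqnorm (V^~ x) => [|//].
by apply/funext => i; rewrite /sqnorm innerNl innerNr opprK.
Qed.

Lemma frame_bessel (V : J -> H -> H) (lo up : R) :
  operator_frame_bounds V lo up -> bessel V.
Proof.
move=> [_ _ up0 Vle]; exists up => // x; have [Vx _ le] := Vle x; split=> //.
rewrite -[X in X * _]gtr0_norm// -rnormZr.
by apply: cstar_le_rnorm le; exact: series_sum_pos (@sqnorm_pos _) Vx.
Qed.

(** With [inner_act_act], this turns a norm bound at all vectors into one for all conjugates of the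
    two forms at [x]. *)
Lemma series_sum_sqnorm_act (V : J -> H -> H) a x :
  (forall i, adjointable (V i)) -> ell2 (V^~ x) ->
  series_sum (sqnorm (V^~ (act a x))) = a * series_sum (sqnorm (V^~ x)) * star a.
Proof.
move=> adjV Vx; rewrite -series_sum_conj//; congr series_sum.
apply/funext => i; rewrite /sqnorm (adjointable_act a x (adjV i)).
exact: inner_act_act.
Qed.

(** [cstar_le_of_conj_norm] applies twice, with the two forms exchanged; the lower bound is then
    divided by [C]. *)
Lemma operator_frame_of_norm (V : J -> H -> H) (C : R) :
  (forall i, adjointable (V i)) -> bessel V -> 0 < C ->
  (forall x, rnorm (inner x x) <= C * rnorm (series_sum (sqnorm (V^~ x)))) ->
  operator_frame V.
Proof.
move=> adjV [B B0 VB] C0 VC; exists C^-1, B; split=> //; first by rewrite invr_gt0.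
move=> x; have [Vx _] := VB x.
have pV : cstar_pos (series_sum (sqnorm (V^~ x))).
  exact: series_sum_pos (@sqnorm_pos _) Vx.
have px : cstar_pos (inner x x) by exact: inner_pos.
split=> //; last first.
  apply: cstar_le_of_conj_norm px _ => [||b]; [exact: ltW|exact: pV.1|].
  rewrite -series_sum_sqnorm_act// -inner_act_act; exact: (VB _).2.
have Ci0 : 0 <= C^-1 by rewrite invr_ge0 ltW.
have xV : cstar_le (inner x x) (C%:C *: series_sum (sqnorm (V^~ x))).
  apply: cstar_le_of_conj_norm pV _ => [||b]; [exact: ltW|exact: px.1|].
  by rewrite -series_sum_sqnorm_act// -inner_act_act; exact: VC.
have := cstar_posZ Ci0 xV; rewrite scalerBr scalerA -rmorphM /=.
by rewrite mulVf ?gt_eqF// scale1r.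
Qed.

Lemma ell2_norm_le (x y : J -> H) (M : R) :
  ell2_norm x <= M%:C * ell2_norm y ->
  rnorm (series_sum (sqnorm x)) <= M ^+ 2 * rnorm (series_sum (sqnorm y)).
Proof.
move=> xy; rewrite -lecR rmorphM rmorphXn /= -!rnormE.
rewrite -[X in X <= _](sqrtCK) -[X in _ <= _ * X]sqrtCK -exprMn.
(* The sign of [M] is not given; the right side is nonnegative because it dominates this norm. *)
have x0 : 0 <= ell2_norm x by rewrite sqrtC_ge0.
by rewrite ler_pXn2r// nnegrE// (le_trans x0).
Qed.

End Modules.

(** * Perturbation of operator frames *)

Theorem theorem3p9 (R : realType) (A : cstarAlgType R) (H : hilbertModType A)
    (J : set nat) (k : nat) (T U : 'I_k -> J -> H -> H)
    (lo up : 'I_k -> R) (L : (J -> H) -> (J -> H)) (p : 'I_k) (lambda : R) :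
  (forall n, operator_frame_bounds (T n) (lo n) (up n)) ->
  (forall n i, adjointable (U n i)) ->
  ell2_bounded_linear L ->
  (forall x : H, L (fun i => \sum_(n < k) U n i x) = (fun i => T p i x)) ->
  0 < lambda ->
  (forall (n : 'I_k) (x : H),
     ell2 (fun i => T n i x - U n i x) /\
     `|series_sum (sqnorm (fun i => T n i x - U n i x))|
       <= lambda%:C * `|series_sum (sqnorm (fun i => T n i x))|) ->
  operator_frame (fun i x => \sum_(n < k) U n i x).
Proof.
move=> frT adjU [_ _ [M LM]] LU lambda0 TU.
have bT n : bessel (T n) := frame_bessel (frT n).
have bTU n : bessel (fun i x => T n i x - U n i x).
  have [C C0 TC] := bT n; exists (lambda * C); first exact: mulr_gt0.
  move=> x; have [sTU] := TU n x; rewrite !rnormE -rmorphM /= lecR => TUle.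
  by split=> //; apply: le_trans TUle _; rewrite -mulrA ler_pM2l//; case: (TC x).
(* [U = T - (T - U)], a difference of Bessel families. *)
have bU n : bessel (U n).
  have := besselD (bT n) (besselN (bTU n)); congr bessel.
  by apply/funext => i; apply/funext => x; rewrite opprB addrC subrK.
have bS := bessel_sum (index_enum 'I_k) bU.
have [_ lo0 _ Tlo] := frT p.
(* With [S] the summed family, [lo p * |<x,x>| <= |sum of T p| <= M^2 * |sum of S|], the last step
   by applying [L]. The [+ 1] keeps the constant positive when [M = 0]. *)
apply: (@operator_frame_of_norm _ _ _ _ _ ((M ^+ 2 + 1) / lo p)) => //.
- by move=> i; exact: adjointable_sum.
- by rewrite divr_gt0// ltr_wpDl// sqr_ge0.
move=> x; rewrite mulrAC ler_pdivlMr// mulrC -[X in X * _]gtr0_norm// -rnormZr.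
have [Tx loT _] := Tlo x.
apply: le_trans (cstar_le_rnorm _ loT) _.
  by apply: cstar_posZ (inner_pos x); exact: ltW.
have [_ _ /(_ x)[Sx _]] := bS.
have := LM _ Sx; rewrite LU => /ell2_norm_le h.
by apply: le_trans h _; rewrite ler_wpM2r ?rnorm_ge0//; lra.
Qed.
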